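(* Let $n,k\ge1$. The graph $nK_2$ admits a $k$-super graceful labeling in which the $n$ largest labels $k+2n,\dots,k+3n-1$ are assigned to $n$ mutually non-adjacent vertices if and only if $n=2k-1$. Moreover, $(2k-1)K_2$ admits a $k$-super graceful labeling whose edge-label set is $[k,3k-2]$.
   Context: $nK_2$ denotes the disjoint union of $n$ copies of $K_2$. For integers $a\le b$, $[a,b]$ is the set of integers between $a$ and $b$ inclusive. For $k\ge 1$, a $k$-super graceful labeling of a graph $G=(V,E)$ with $p$ vertices and $q$ edges is a bijection $f:V\cup E\to[k,k+p+q-1]$ with $f(uv)=|f(u)-f(v)|$ for every edge $uv$. *)

(* Defs.v *)
From mathcomp Require Import all_boot all_order all_algebra.

Set Implicit Arguments.
Unset Strict Implicit.
Unset Printing Implicit Defensive.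

Record sgraph := SGraph {
  vertex :> finType;
  adj : rel vertex;
  adj_sym : symmetric adj;
  adj_irr : irreflexive adj
}.

Definition edges (G : sgraph) : {set {set G}} :=
  [set [set u; v] | u in G, v in G & adj u v].

Definition edge (G : sgraph) : finType := {e : {set G} | e \in edges G}.

Definition non_adjacent (G : sgraph) (S : {set G}) : Prop :=
  {in S &, forall u v, ~~ adj u v}.

Lemma complete_sym m : symmetric (fun u v : 'I_m => u != v).
Proof. by move=> u v; rewrite eq_sym. Qed.

Lemma complete_irr m : irreflexive (fun u v : 'I_m => u != v).
Proof. by move=> u; rewrite eqxx. Qed.

Definition complete (m : nat) : sgraph :=
  SGraph (@complete_sym m) (@complete_irr m).

Definition copies_adj (n : nat) (G : sgraph) : rel ('I_n * G) :=
  fun x y => (x.1 == y.1) && adj x.2 y.2.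

Lemma copies_sym n G : symmetric (@copies_adj n G).
Proof. by move=> x y; rewrite /copies_adj eq_sym adj_sym. Qed.

Lemma copies_irr n G : irreflexive (@copies_adj n G).
Proof. by move=> x; rewrite /copies_adj adj_irr andbF. Qed.

Definition copies (n : nat) (G : sgraph) : sgraph :=
  SGraph (@copies_sym n G) (@copies_irr n G).

Definition intv (a b : nat) : pred nat := [pred m | a <= m <= b].

(* [inl v] stands for the vertex v and [inr e] for the edge e. The notation   *)
(* `|x - y|%N is the absolute value of the integer difference of x and y.     *)
Definition super_graceful (k : nat) (G : sgraph) (f : G + edge G -> nat) :=
  [/\ injective f,
      codom f =i intv k (k + #|G| + #|edges G| - 1)
    & forall (e : edge G) (u v : G), val e = [set u; v] ->
        f (inr e) = `|f (inl u) - f (inl v)|%N].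

Definition edge_labels (G : sgraph) (f : G + edge G -> nat) : seq nat :=
  [seq f (inr e) | e : edge G].

(* Main.v *)
Require Import Defs.
From mathcomp Require Import all_boot all_order all_algebra.
From mathcomp Require Import zify.

(** In every component the label of one end is the sum of the two other labels.
    If the [n] largest labels lie on pairwise non-adjacent vertices, there is one
    of them in each component, so the sum of all the [3n] labels is twice the sum
    of the [n] largest ones; this forces [n = 2k - 1].  Conversely, for
    [n = 2k - 1] the component [i < n] gets the edge label [k + i] and the vertex
    labels [a] and [a + k + i], where [a = 4k - 2 - j] if [i = 2j] and
    [a = 5k - 3 - j] if [i = 2j + 1]: the larger vertex label is then
    [5k - 2 + j] or [6k - 2 + j], and the three kinds of labels fill
    [[k, 3k - 2]], [[3k - 1, 5k - 3]] and [[5k - 2, 7k - 4]]. *)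

(** * Labels filling an interval, and the sum of an interval *)

(** Pigeonhole: [#|T|] distinct values inside an interval of [#|T|] integers exhaust it. For empty
    [T] and [a = 0] the truncated bound [a + #|T| - 1] would leave the spurious point 0. *)
Lemma codom_intv (T : finType) (f : T -> nat) a :
    0 < #|T| -> injective f -> (forall x, a <= f x < a + #|T|) ->
  codom f =i intv a (a + #|T| - 1).
Proof.
move=> T_gt0 f_inj f_bnd m.
have f_uniq : uniq (codom f) by apply/injectiveP.
have f_sub : {subset codom f <= iota a #|T|}.
  by move=> _ /codomP[x ->]; rewrite mem_iota.
rewrite (uniq_min_size f_uniq f_sub) ?size_codom ?size_iota // mem_iota inE.
by apply/idP/idP; lia.
Qed.

(** Gauss's formula, doubled and with [n] moved to the left so that neither division nor truncated
    subtraction occurs. *)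
Lemma sum_iota a n : 2 * (\sum_(x <- iota a n) x) + n = n * (2 * a + n).
Proof.
elim: n => [|n IHn]; first by rewrite big_nil.
by rewrite -[in iota _ _]addn1 iotaD big_cat big_seq1 /=; nia.
Qed.

Lemma sum_intv (s : seq nat) a n :
    0 < n -> uniq s -> s =i intv a (a + n - 1) ->
  2 * (\sum_(x <- s) x) + n = n * (2 * a + n).
Proof.
move=> n_gt0 s_uniq s_intv; rewrite -(sum_iota a n); congr (2 * _ + n).
apply/perm_big/uniq_perm; rewrite ?iota_uniq // => x.
by rewrite s_intv mem_iota inE; apply/idP/idP; lia.
Qed.

(** The one number that reaches [m] is the larger one, and [a + b + |a - b|] is twice the
    maximum. *)
Lemma sum_distn_threshold (a b m : nat) :
    (m <= a) + (m <= b) = 1 ->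
  a + b + `|a - b|%N = 2 * ((m <= a) * a + (m <= b) * b).
Proof. by do 2![case: leqP => ? /=]; rewrite ?mul1n ?mul0n; lia. Qed.

(** * Vertices, edges and sums over the components of [nK_2] *)

Section Matching.
Variable n : nat.
Local Notation G := (copies n (complete 2)).

Definition lo (i : 'I_n) : G := (i, ord0).
Definition hi (i : 'I_n) : G := (i, lift ord0 ord0).

Lemma matching_vertexP (v : G) : v = lo v.1 \/ v = hi v.1.
Proof.
case: v => i [[|[|b]] b_lt] //; [left | right]; congr pair; exact: val_inj.
Qed.

Lemma adj_lo_hi i : adj (lo i) (hi i).
Proof. by rewrite /= /copies_adj /= eqxx. Qed.

Lemma matching_edge_subproof i : [set lo i; hi i] \in edges G.
Proof. by apply/imset2P; exists (lo i) (hi i); rewrite ?inE ?adj_lo_hi. Qed.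

Definition matching_edge i : edge G :=
  exist (fun e => e \in edges G) [set lo i; hi i] (matching_edge_subproof i).

Lemma matching_edge_inj : injective matching_edge.
Proof.
move=> i j /(congr1 val) /= /setP/(_ (lo i)); rewrite !inE eqxx /=.
by case/esym/orP=> /eqP[].
Qed.

Lemma matching_edgeP (e : edge G) : exists i, e = matching_edge i.
Proof.
case: e => e e_edge; case/imset2P: (e_edge) => u v _ + e_def.
rewrite inE /= /copies_adj => /andP[/eqP uv1 uv2].
exists u.1; apply: val_inj; rewrite /= {}e_def.
case: (matching_vertexP u) (matching_vertexP v) uv2 => -> [] ->;
  rewrite -?uv1 ?eqxx //= => _.
by rewrite setUC.
Qed.

Lemma matching_edge_bij : bijective matching_edge.
Proof.
have sur e : [exists i, e == matching_edge i].
  by case: (matching_edgeP e) => i ->; apply/existsP; exists i.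
exists (fun e => xchoose (existsP (sur e))) => [i|e].
  by apply: matching_edge_inj; rewrite -(eqP (xchooseP (existsP (sur _)))).
by rewrite -(eqP (xchooseP (existsP (sur _)))).
Qed.

Lemma card_matching_edge : #|edge G| = n.
Proof. by rewrite -(bij_eq_card matching_edge_bij) card_ord. Qed.

Lemma card_matching_edges : #|edges G| = n.
Proof. by rewrite -[RHS]card_matching_edge card_sig. Qed.

Lemma card_matching : #|G| = 2 * n.
Proof. by rewrite card_prod !card_ord mulnC. Qed.

(** The indicator factors let one formula serve both for sums over all vertices and for sums over a
    set [S]. *)
Lemma sum_matching (F : G -> nat) (P : pred G) :
  \sum_(v | P v) F v =
  \sum_(i < n) (P (lo i) * F (lo i) + P (hi i) * F (hi i)).
Proof.
rewrite big_mkcond /= (eq_bigr (fun v : G => P (v.1, v.2) * F (v.1, v.2))).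
  rewrite -(pair_bigA _ (fun i b => P (i, b) * F (i, b))) /=.
  by apply: eq_bigr => i _; rewrite !big_ord_recl big_ord0 addn0.
by move=> [i b] _ /=; case: (P _); rewrite ?mul1n ?mul0n.
Qed.

(** Each of the [n] components meets [S] at most once because its two ends are adjacent; as the
    total is [n], equality holds in every component. *)
Lemma matching_transversal (S : {set G}) i :
  #|S| = n -> non_adjacent S -> (lo i \in S) + (hi i \in S) = 1.
Proof.
move=> S_card S_indep.
have le1 j : (lo j \in S) + (hi j \in S) <= 1.
  have := S_indep (lo j) (hi j).
  case: (lo j \in S); case: (hi j \in S) => // /(_ isT isT).
  by rewrite adj_lo_hi.
have := leqif_sum (fun (j : 'I_n) (_ : true) => leqif_eq (le1 j)).
rewrite sum1_card card_ord => -[_].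
have <- : #|S| = \sum_(j < n) ((lo j \in S) + (hi j \in S)).
  rewrite -sum1_card sum_matching; apply: eq_bigr => j _; lia.
by rewrite S_card eqxx => /esym/forallP/(_ i)/eqP.
Qed.

(** * Necessity of [n = 2k - 1], by double counting *)

Lemma top_labels_on_matching k (f : G + edge G -> nat) (S : {set G}) :
    0 < n -> super_graceful k f -> #|S| = n -> non_adjacent S ->
    [seq f (inl v) | v in S] =i intv (k + 2 * n) (k + 3 * n - 1) ->
  n = 2 * k - 1.
Proof.
move=> n_gt0 [f_inj f_codom f_edge] S_card S_indep S_top.
move: f_codom; rewrite card_matching card_matching_edges => f_codom.
have inl_inj : injective (fun v : G => f (inl v)) by move=> u v /f_inj[].
have f_le x : f x <= k + 2 * n + n - 1.
  have /[!f_codom]/[!inE] := codom_f f x; lia.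
(* As no label exceeds [k + 3n - 1], membership in [S] becomes a threshold test on the label. *)
have f_top v : (k + 2 * n <= f (inl v)) = (v \in S).
  have -> : (k + 2 * n <= f (inl v)) = (f (inl v) \in [seq f (inl v) | v in S]).
    by rewrite S_top inE; have le_f := f_le (inl v); apply/idP/idP; lia.
  exact: (mem_image inl_inj).
have sum_all := @sum_intv (codom f) k (3 * n).
have {}sum_all : 2 * (\sum_(x <- codom f) x) + 3 * n = 3 * n * (2 * k + 3 * n).
  apply: sum_all => [||x]; first by lia.
    exact/injectiveP.
  by rewrite f_codom !inE; congr (_ && (_ <= _)); lia.
have sum_top : 2 * (\sum_(v in S) f (inl v)) + n = n * (2 * (k + 2 * n) + n).
  rewrite -(@sum_intv [seq f (inl v) | v in S] (k + 2 * n) n) //.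
  - by rewrite big_image.
  - by rewrite map_inj_uniq ?enum_uniq.
  - by move=> x; rewrite S_top !inE; congr (_ && (_ <= _)); lia.
have all_top : \sum_(x <- codom f) x = 2 * (\sum_(v in S) f (inl v)).
  rewrite big_image /= big_sumType /= !sum_matching.
  rewrite (reindex matching_edge) /=; last exact/onW_bij/matching_edge_bij.
  rewrite -big_split big_distrr /=; apply: eq_bigr => i _.
  have := matching_transversal S i S_card S_indep.
  rewrite (f_edge _ (lo i) (hi i)) // -!f_top !mul1n.
  exact: sum_distn_threshold.
(* Eliminating the sum over [S] gives [2n(2k + 5n) + n = 3n(2k + 3n)]; dividing by [n > 0] leaves
   [n + 1 = 2k]. *)
move: sum_all sum_top; rewrite all_top; nia.
Qed.

End Matching.

(** * The explicit labeling for [n = 2k - 1] *)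

Definition lo_label k i := if odd i then 5 * k - 3 - i./2 else 4 * k - 2 - i./2.

(** Both ends of an edge have the same component index, so the maximum merely reads off [k + i] from
    the edge as a set, with no choice of an endpoint. *)
Definition matching_label k n
    (x : copies n (complete 2) + edge (copies n (complete 2))) : nat :=
  match x with
  | inl v => lo_label k v.1 + (if v.2 == ord0 then 0 else k + v.1)
  | inr e => \max_(v in val e) (k + v.1)
  end.
Arguments matching_label : clear implicits.

Section MatchingLabel.
Variables k n : nat.
Hypotheses (k_gt0 : 0 < k) (n_def : n = 2 * k - 1).
Local Notation f := (matching_label k n).

Lemma matching_label_lo i : f (inl (lo n i)) = lo_label k i.
Proof. by rewrite /= addn0. Qed.

Lemma matching_label_hi i : f (inl (hi n i)) = lo_label k i + (k + i).
Proof. by []. Qed.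

Lemma matching_label_edge i : f (inr (matching_edge n i)) = k + i.
Proof.
by rewrite /= big_setU1 ?big_set1 /= ?maxnn // inE; apply/eqP=> -[].
Qed.

Lemma lo_label_bounds (i : 'I_n) : 3 * k - 1 <= lo_label k i <= 5 * k - 3.
Proof. have := ltn_ord i; rewrite /lo_label; case: ifP; lia. Qed.

Lemma hi_label_bounds (i : 'I_n) :
  5 * k - 2 <= lo_label k i + (k + i) <= 7 * k - 4.
Proof. have := ltn_ord i; rewrite /lo_label; case: ifP; lia. Qed.

(** Even indices land in [[3k - 1, 4k - 2]] and odd ones in [[4k - 1, 5k - 3]]; within each parity
    the label decreases with [i]. *)
Lemma lo_label_inj (i j : 'I_n) : lo_label k i = lo_label k j -> i = j.
Proof.
move=> eq_ij; apply: val_inj => /=; move: eq_ij.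
have := ltn_ord i; have := ltn_ord j.
by rewrite /lo_label; case: ifP; case: ifP; lia.
Qed.

(** Here even indices land in [[5k - 2, 6k - 3]] and odd ones in [[6k - 2, 7k - 4]], increasingly
    within each parity. *)
Lemma hi_label_inj (i j : 'I_n) :
  lo_label k i + (k + i) = lo_label k j + (k + j) -> i = j.
Proof.
move=> eq_ij; apply: val_inj => /=; move: eq_ij.
have := ltn_ord i; have := ltn_ord j.
by rewrite /lo_label; case: ifP; case: ifP; lia.
Qed.

Variant matching_elt_spec :
    copies n (complete 2) + edge (copies n (complete 2)) -> Prop :=
  | MatchingLo i : matching_elt_spec (inl (lo n i))
  | MatchingHi i : matching_elt_spec (inl (hi n i))
  | MatchingEdge i : matching_elt_spec (inr (matching_edge n i)).

Lemma matching_eltP x : matching_elt_spec x.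
Proof.
case: x => [v|e]; last by case: (matching_edgeP n e) => i ->; constructor.
by case: (matching_vertexP n v) => ->; constructor.
Qed.

Lemma matching_label_inj : injective f.
Proof.
move=> x y.
(* Labels of different kinds lie in disjoint intervals, so only the three cases of equal kind
   survive [lia]. *)
case: (matching_eltP x) => i; case: (matching_eltP y) => j;
  rewrite ?matching_label_lo ?matching_label_hi ?matching_label_edge => eq_ij;
  have := ltn_ord i; have := ltn_ord j; have := lo_label_bounds i;
  have := lo_label_bounds j; have := hi_label_bounds i;
  have := hi_label_bounds j; try lia.
- by rewrite (lo_label_inj i j).
- by rewrite (hi_label_inj i j).
- by move=> *; congr (inr (matching_edge n _)); apply: val_inj => /=; lia.
Qed.

Lemma matching_label_super_graceful : super_graceful k f.
Proof.
split; first exact: matching_label_inj.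
  have card_elt : #|{: copies n (complete 2) + edge (copies n (complete 2))}|
                  = 3 * n.
    by rewrite card_sum card_matching card_matching_edge; lia.
  have -> : k + #|copies n (complete 2)| + #|edges (copies n (complete 2))| - 1
    = k + #|{: copies n (complete 2) + edge (copies n (complete 2))}| - 1.
    by rewrite card_elt card_matching card_matching_edges; lia.
  apply: codom_intv; rewrite ?card_elt; first by lia.
    exact: matching_label_inj.
  move=> x; case: (matching_eltP x) => i;
    rewrite ?matching_label_lo ?matching_label_hi ?matching_label_edge;
    have := ltn_ord i; have := lo_label_bounds i; have := hi_label_bounds i;
    lia.
move=> e u v; case: (matching_edgeP n e) => i -> e_uv.
(* An edge is an unordered pair, so its ends may come in either order; [u = v] is excluded since the
   pair would miss [lo n i] or [hi n i]. *)
have [[-> ->] | [-> ->]] :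
    u = lo n i /\ v = hi n i \/ u = hi n i /\ v = lo n i.
  have {}e_uv : [set lo n i; hi n i] = [set u; v] := e_uv.
  have : u \in [set lo n i; hi n i] by rewrite e_uv set21.
  have : v \in [set lo n i; hi n i] by rewrite e_uv set22.
  move/setP: e_uv => e_uv; have := (e_uv (lo n i), e_uv (hi n i)).
  rewrite !inE !eqxx orbT => -[lo_uv hi_uv] /orP[]/eqP v_def /orP[]/eqP u_def.
  - by move: hi_uv; rewrite u_def v_def orbb => /esym/eqP[].
  - by right.
  - by left.
  - by move: lo_uv; rewrite u_def v_def orbb => /esym/eqP[].
all: by rewrite matching_label_edge matching_label_lo matching_label_hi; lia.
Qed.

Lemma matching_label_edge_labels : edge_labels f =i intv k (3 * k - 2).
Proof.
have -> : 3 * k - 2 = k + #|edge (copies n (complete 2))| - 1.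
  by rewrite card_matching_edge; lia.
apply: (@codom_intv _ (fun e => f (inr e))); rewrite ?card_matching_edge.
- by lia.
- by move=> e e' /matching_label_inj[].
- move=> e; case: (matching_edgeP n e) => i ->; rewrite matching_label_edge.
  have := ltn_ord i; lia.
Qed.

(** For [n = 2k - 1] the interval is [[5k - 2, 7k - 4]], exactly the range of [hi_label_bounds],
    which [n] distinct labels must fill. *)
Lemma matching_label_hi_labels :
  [seq f (inl v) | v in [set hi n i | i : 'I_n]]
    =i intv (k + 2 * n) (k + 3 * n - 1).
Proof.
have hi_codom := @codom_intv _ (fun i : 'I_n => f (inl (hi n i))) (k + 2 * n).
have {}hi_codom : codom (fun i : 'I_n => f (inl (hi n i)))
    =i intv (k + 2 * n) (k + 3 * n - 1).
  have -> : k + 3 * n - 1 = k + 2 * n + #|'I_n| - 1 by rewrite card_ord; lia.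
  apply: hi_codom; rewrite ?card_ord; first by lia.
    by move=> i j /hi_label_inj.
  by move=> i; rewrite matching_label_hi; have := hi_label_bounds i; lia.
move=> m; rewrite -hi_codom; apply/imageP/codomP.
  by case=> _ /imsetP[i _ ->] ->; exists i.
by case=> i ->; exists (hi n i) => //; apply: imset_f.
Qed.

End MatchingLabel.

Lemma hi_non_adjacent n : non_adjacent [set hi n i | i : 'I_n].
Proof.
move=> _ _ /imsetP[i _ ->] /imsetP[j _ ->].
by rewrite /= /copies_adj /= andbF.
Qed.

Theorem theorem3p14 (n k : nat) (hn : 1 <= n) (hk : 1 <= k) :
  ((exists f : copies n (complete 2) + edge (copies n (complete 2)) -> nat,
      super_graceful k f /\
      exists S : {set copies n (complete 2)},
        [/\ #|S| = n,
            non_adjacent S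
          & [seq f (inl v) | v in S] =i intv (k + 2 * n) (k + 3 * n - 1)])
   <-> n = 2 * k - 1)
  /\
  (exists f : copies (2 * k - 1) (complete 2)
                + edge (copies (2 * k - 1) (complete 2)) -> nat,
     super_graceful k f /\ edge_labels f =i intv k (3 * k - 2)).
Proof.
split; last first.
  exists (matching_label k (2 * k - 1)).
  by split; [apply: matching_label_super_graceful
            | apply: matching_label_edge_labels].
split=> [[f [f_sg [S [S_card S_indep S_top]]]] | n_def].
  exact: top_labels_on_matching S_top.
exists (matching_label k n); split; first exact: matching_label_super_graceful.
exists [set hi n i | i : 'I_n]; split.
- by rewrite card_imset ?card_ord // => i j [].
- exact: hi_non_adjacent.
- exact: matching_label_hi_labels.
Qed.
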